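(* (i) Let $d\in\{2,3\}$ and let $n$ be a positive integer. Then for any simplicial sequence $\mathbf{e}=e_1,\ldots,e_t$ of the complete $d$-uniform clutter $\mathcal{C}_{n,d}$ on $[n]$, the clutter $(\mathcal{C}_{n,d})_{\mathbf{e}}^t$ is chordal. (ii) Let $n$ be a positive integer and $i\ge 0$ an integer with $i\ge n-3$. Then the simplicial complex $\langle[n]\rangle^{(i)}$ is extendably shellable.
   Context: A clutter $\mathcal{C}$ on the vertex set $[n]=\{1,\dots,n\}$ is a collection of subsets of $[n]$ (called circuits) none of which is contained in another; it is $d$-uniform if every circuit has exactly $d$ elements. The complete $d$-uniform clutter on $[n]$ is $\mathcal{C}_{n,d}=\{F\subseteq[n]: |F|=d\}$ (with no circuits if $n<d$). A subset $F\subseteq[n]$ is a clique in a $d$-uniform clutter $\mathcal{C}$ if either $|F|<d$ or all $d$-subsets of $F$ belong to $\mathcal{C}$. For a $(d-1)$-subset $e$ of $[n]$, let $N_{\mathcal{C}}[e]=e\cup\{c\in[n]: e\cup\{c\}\in\mathcal{C}\}$; $e$ is simplicial over $\mathcal{C}$ if $N_{\mathcal{C}}[e]$ is a clique in $\mathcal{C}$ (in particular if $N_{\mathcal{C}}[e]=e$), and $e$ is a maximal subcircuit of $\mathcal{C}$ if $N_{\mathcal{C}}[e]\neq e$. A simplicial maximal subcircuit is a maximal subcircuit that is simplicial over $\mathcal{C}$. The deletion of $e$ is $\mathcal{C}\setminus e=\{F\in\mathcal{C}: e\nsubseteq F\}$. For a sequence $\mathbf{e}=e_1,\ldots,e_t$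 of $(d-1)$-subsets put $\mathcal{C}_{\mathbf{e}}^0=\mathcal{C}$ and $\mathcal{C}_{\mathbf{e}}^i=(\mathcal{C}\setminus e_1)\setminus\cdots\setminus e_i$ for $i\ge1$. The sequence $\mathbf{e}$ is a simplicial sequence in $\mathcal{C}$ if $e_i$ is simplicial over $\mathcal{C}_{\mathbf{e}}^{i-1}$ for all $1\le i\le t$. A $d$-uniform clutter $\mathcal{C}$ is chordal if either $\mathcal{C}=\varnothing$, or $\mathcal{C}$ has a simplicial maximal subcircuit $e$ such that $\mathcal{C}\setminus e$ is chordal. Simplicial complexes: $\langle F_1,\ldots,F_t\rangle$ denotes the complex with facets $F_1,\ldots,F_t$, so $\langle[n]\rangle$ is the full simplex on $[n]$; $\Delta^{(i)}$ is the $i$-th skeleton, consisting of all faces of $\Delta$ of dimension (cardinality minus one) at most $i$. A shelling of a simplicial complex is a total order $F_1,\ldots,F_t$ of its facets such that $\langle F_1,\ldots,F_{i-1}\rangle\cap\langle F_i\rangle$ is generated by a non-empty set of maximal proper faces of $F_i$ for $2\le i\le t$. A complex $\Delta$ is extendably shellable if any shelling $F_1,\ldots,F_s$ of a subcomplex $\Gamma$ whose facets are all facets of $\Delta$ can be continued to a shelling $F_1,\ldots,F_s,F_{s+1},\ldots,F_t$ of $\Delta$. *)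

(* Defs.v *)
From mathcomp Require Import all_boot.

Set Implicit Arguments.
Unset Strict Implicit.
Unset Printing Implicit Defensive.

Section Clutters.
Variable T : finType.
Implicit Types (d : nat) (C : {set {set T}}) (e F G : {set T}).

(* Sets of equal size are never strictly nested, so a d-uniform family is
   automatically a clutter. *)
Definition uniform d C : Prop := forall F, F \in C -> #|F| = d.

Definition complete_clutter d : {set {set T}} := [set F : {set T} | #|F| == d].

Definition clique d C F : Prop :=
  #|F| < d \/ forall G, G \subset F -> #|G| = d -> G \in C.

Definition neighborhood C e : {set T} := e :|: [set c | (c |: e) \in C].

Definition simplicial d C e : Prop :=
  #|e| = d.-1 /\ clique d C (neighborhood C e).

Definition maximal_subcircuit d C e : Prop :=
  #|e| = d.-1 /\ neighborhood C e <> e.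

Definition deletion C e : {set {set T}} := [set F in C | ~~ (e \subset F)].

Definition deletions C (es : seq {set T}) : {set {set T}} :=
  foldl deletion C es.

(* The 0-based entry [nth set0 es i] is e_(i+1), and
   [deletions C (take i es)] is C with e_1, ..., e_i deleted. *)
Definition simplicial_sequence d C (es : seq {set T}) : Prop :=
  forall i, i < size es ->
    simplicial d (deletions C (take i es)) (nth set0 es i).

Inductive chordal d : {set {set T}} -> Prop :=
| chordal_empty : chordal d set0
| chordal_deletion C e :
    uniform d C -> maximal_subcircuit d C e -> simplicial d C e ->
    chordal d (deletion C e) -> chordal d C.

End Clutters.

Section Complexes.
Variable T : finType.
Implicit Types (D E A : {set {set T}}) (F G : {set T}) (s : seq {set T}).

(* Vertices need not be faces, and the void complex [set0] is allowed. *)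
Definition simplicial_complex D : Prop :=
  forall F G, F \in D -> G \subset F -> G \in D.

Definition facets D : {set {set T}} :=
  [set F : {set T} | maxset (fun G => G \in D) F].

Definition generated A : {set {set T}} :=
  [set G : {set T} | [exists F in A, G \subset F]].

(* dim F <= i, where dim F = #|F| - 1 and the empty face has dimension -1. *)
Definition skeleton (i : nat) D : {set {set T}} := [set F in D | #|F| <= i.+1].

Definition maximal_proper_faces F : {set {set T}} :=
  [set G : {set T} | maxset (fun H : {set T} => H \proper F) G].

(* Complexes need not be pure. The entry at 0-based index k is F_(k+1) and
   [take k s] lists F_1, ..., F_k. *)
Definition shelling D s : Prop :=
  [/\ uniq s, [set F in s] = facets D &
      forall k, 0 < k < size s ->
        let F := nth set0 s k in
        exists A : {set {set T}},
          [/\ A != set0, A \subset maximal_proper_faces F &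
              generated [set G in take k s] :&: generated [set F]
                = generated A]].

Definition extendably_shellable D : Prop :=
  forall E s,
    simplicial_complex E -> E \subset D -> facets E \subset facets D ->
    shelling E s -> exists s', shelling D (s ++ s').

End Complexes.

(* Main.v *)
Require Import Defs.
From mathcomp Require Import all_boot.

Set Implicit Arguments.
Unset Strict Implicit.
Unset Printing Implicit Defensive.

(** Both parts follow from one fact, for
d = 2 and d = 3: as long as a simplicial sequence of the complete clutter leaves
some circuit, the remaining clutter has a simplicial maximal subcircuit
([exists_simplicial_subcircuit]).  Deleting it extends the sequence and lowers
the number of circuits, so the clutter is chordal by induction
([chordal_deletions]).

For d = 2 deleting vertices from a complete graph leaves a complete graph on the
remaining vertices, and any of these is simplicial.  For d = 3 the circuits that
are left are the triangles of the graph [adj es] of pairs that have not been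
deleted, and an edge uv is simplicial exactly when the common neighbours of u
and v form a clique (an exposed edge).  The complete graph is chordal, and
erasing an exposed edge preserves chordality ([chordal_graph_erase]); so
[adj es] is always a chordal graph.  A chordal graph with a triangle has an
exposed edge lying in a triangle ([exposed_triangle]): peel off simplicial
vertices until one of degree at least two appears, and take an edge at it.
Chordality is used in the form that every nonempty induced subgraph has a
simplicial vertex, which makes cycles unnecessary; the tool is Dirac's theorem
that a chordal graph which is not complete has two nonadjacent simplicial
vertices ([dirac]).

For shellings, pass to complements.  Let F be added to a list p of sets of the
same size as F, let e be the complement of F, and call a set free if it contains
the complement of no member of p.  The ridge F minus x lies in the complex
generated by p exactly when e together with x is not free, that is when x is
outside the closed neighbourhood N of e.  Hence F meets that complex in a union
of ridges exactly when no complement of a member of p lies inside N, and this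
says that e is simplicial ([attachesP], [simplicial_free]).  A partial shelling
of the skeleton therefore is a simplicial sequence read through complements.
It extends by the complement of a simplicial maximal subcircuit while circuits
remain, and afterwards by any missing facet, because then N = e. *)


(** * Chordal graphs and exposed edges *)

Section ChordalGraphs.
Variable T : finType.
Implicit Types (g : rel T) (S : {set T}) (a b u v w x y z : T).

Definition gclique g S : bool :=
  [forall x in S, forall y in S, (x != y) ==> g x y].

Definition gsimplicial g S v : bool := gclique g [set w in S | g v w].

(** The hereditary form of the existence of simplicial vertices; it is equivalent
to the absence of induced cycles of length at least four. *)
Definition chordal_graph g : Prop :=
  forall S, S != set0 -> exists2 v, v \in S & gsimplicial g S v.

(** For an edge uv this says that uv lies in a unique maximal clique. *)
Definition exposed g u v : bool := gclique g [set w | g u w && g v w].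

Definition erase g u v : rel T := [rel x y | g x y && ([set x; y] != [set u; v])].

Lemma gcliqueP g S :
  reflect (forall x y, x \in S -> y \in S -> x != y -> g x y) (gclique g S).
Proof.
apply: (iffP forall_inP) => [cl x y xS yS nxy | cl x xS].
  by move/forall_inP: (cl x xS) => /(_ y yS) /implyP; apply.
by apply/forall_inP => y yS; apply/implyP; apply: cl.
Qed.

Lemma gclique_sub g S S' : S \subset S' -> gclique g S' -> gclique g S.
Proof.
by move=> /subsetP sS /gcliqueP cl; apply/gcliqueP => x y /sS xS /sS; apply: cl.
Qed.

Lemma chordal_graph_eq g g' : g =2 g' -> chordal_graph g -> chordal_graph g'.
Proof.
move=> eq_g ch S /ch [v vS /gcliqueP cl]; exists v => //.
apply/gcliqueP => x y; rewrite !inE -!eq_g => xN yN.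
by apply: cl; rewrite inE.
Qed.

Lemma gcliqueU1 g x S : symmetric g ->
  gclique g (x |: S) = gclique g S && [forall y in S, (y != x) ==> g x y].
Proof.
move=> sym; apply/gcliqueP/andP => [cl | [/gcliqueP cl /forall_inP adjx]].
  split; first by apply/gcliqueP => y z yS zS; apply: cl; rewrite in_setU1 ?yS ?zS orbT.
  apply/forall_inP => y yS; apply/implyP; rewrite eq_sym.
  by apply: cl; rewrite in_setU1 ?eqxx ?yS ?orbT.
move=> y z; rewrite !in_setU1 => /predU1P[-> | yS] /predU1P[-> | zS].
- by rewrite eqxx.
- by rewrite eq_sym; apply/implyP/adjx.
- by rewrite sym; apply/implyP/adjx.
- exact: cl.
Qed.

(** Remove a simplicial vertex w of S.  If the rest is a clique, w and a
non-neighbour of w will do.  Otherwise the rest has two nonadjacent simplicial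
vertices by induction; the neighbours of w form a clique, so one of the two is
not adjacent to w, stays simplicial in S, and can be paired with w. *)
Lemma dirac g S :
    symmetric g -> chordal_graph g -> ~~ gclique g S ->
  exists a b, [/\ a \in S, b \in S, a != b, ~~ g a b &
                  gsimplicial g S a /\ gsimplicial g S b].
Proof.
move=> sym ch; have [m] := ubnP #|S|; elim: m S => // m IH S leSm ncl.
have S0 : S != set0.
  by apply: contraNneq ncl => ->; apply/gcliqueP => x y; rewrite inE.
have [w wS simw] := ch S S0.
have clw : forall x y, x \in S -> g w x -> y \in S -> g w y -> x != y -> g x y.
  by move=> x y xS wx yS wy; apply: (gcliqueP _ _ simw); rewrite inE ?xS ?yS.
have [cl' | ncl'] := boolP (gclique g (S :\ w)).
  have [x [xS nxw ngwx]] : exists x, [/\ x \in S, x != w & ~~ g w x].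
    case: (boolP [exists x in S, (x != w) && ~~ g w x]).
      by case/exists_inP => x xS /andP[? ?]; exists x.
    move=> /exists_inPn adjw; case/negP: ncl; apply/gcliqueP => x y xS yS nxy.
    have adj z : z \in S -> z != w -> g w z.
      by move=> zS nzw; move: (adjw z zS); rewrite nzw /= negbK.
    have [xw | nxw] := eqVneq x w; first by rewrite xw adj // -xw eq_sym.
    have [yw | nyw] := eqVneq y w; first by rewrite yw sym adj.
    by apply: (gcliqueP _ _ cl'); rewrite // in_setD1 ?nxw ?nyw.
  exists w, x; split=> //; first by rewrite eq_sym.
  split=> //; apply: gclique_sub cl'; apply/subsetP => y.
  rewrite !inE => /andP[yS gxy]; rewrite yS andbT.
  by apply: contraNneq ngwx => <-; rewrite sym.
have ltS : #|S :\ w| < m by move: leSm; rewrite (cardsD1 w S) wS.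
have extend a : a \in S :\ w -> ~~ g w a -> gsimplicial g (S :\ w) a ->
  exists a' b, [/\ a' \in S, b \in S, a' != b, ~~ g a' b &
                  gsimplicial g S a' /\ gsimplicial g S b].
  rewrite in_setD1 => /andP[naw aS] ngwa sima.
  exists w, a; split=> //; first by rewrite eq_sym.
  split=> //; apply: gclique_sub sima; apply/subsetP => y.
  rewrite !inE => /andP[-> gay]; rewrite gay !andbT.
  by apply: contraNneq ngwa => <-; rewrite sym.
have [a [b [aS bS nab ngab [sima simb]]]] := IH _ ltS ncl'.
have [gwa | ] := boolP (g w a); last by move=> ngwa; apply: extend ngwa sima.
have [gwb | ] := boolP (g w b); last by move=> ngwb; apply: extend ngwb simb.
case/negP: ngab; move: aS bS; rewrite !in_setD1 => /andP[_ aS] /andP[_ bS].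
exact: clw.
Qed.

(** In S, a simplicial vertex is spoiled by the erasure only if it is a common
neighbour of u and v.  Common neighbours are pairwise adjacent, so two
nonadjacent simplicial vertices cannot both be spoiled; if S is a clique
containing u, then u itself is simplicial afterwards. *)
Lemma chordal_graph_erase g u v :
    symmetric g -> irreflexive g -> chordal_graph g -> exposed g u v ->
  chordal_graph (erase g u v).
Proof.
move=> sym irr ch /gcliqueP exp S S0.
have keep S' : gclique g S' -> ~~ ((u \in S') && (v \in S')) ->
    gclique (erase g u v) S'.
  move=> /gcliqueP cl nuv; apply/gcliqueP => x y xS yS nxy.
  rewrite /erase /= cl //=; apply: contraNneq nuv => exy.
  have : [set u; v] \subset S' by rewrite -exy subUset !sub1set xS yS.
  by rewrite subUset !sub1set.
have survive w : gsimplicial g S w -> ~~ (g u w && g v w) ->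
    gsimplicial (erase g u v) S w.
  move=> simw nw; apply: keep.
    apply: gclique_sub simw; apply/subsetP => x.
    by rewrite !inE => /and3P[-> -> _].
  apply: contraNN nw; rewrite !inE => /andP[/and3P[_ wu _] /and3P[_ wv _]].
  by rewrite ![g _ w]sym wu wv.
have [clS | /(dirac sym ch) [a [b [aS bS nab ngab [sima simb]]]]] :=
  boolP (gclique g S).
  have simS w : gsimplicial g S w.
    by apply: gclique_sub clS; apply/subsetP => x; rewrite inE => /andP[].
  have [uS | nuS] := boolP (u \in S).
    by exists u => //; apply: survive; rewrite ?irr.
  have [w wS] := set0Pn _ S0; exists w => //; apply: keep; last first.
    by rewrite !inE (negPf nuS).
  apply: gclique_sub (simS w); apply/subsetP => x.
  by rewrite !inE => /and3P[-> -> _].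
have [ca | nca] := boolP (g u a && g v a); last by exists a => //; apply: survive.
have [cb | ncb] := boolP (g u b && g v b); last by exists b => //; apply: survive.
by case/negP: ngab; apply: exp; rewrite ?inE.
Qed.

(** Any edge wp at a simplicial vertex w of degree at least two is exposed and
lies in a triangle.  A simplicial vertex of degree at most one is in no
triangle, and is not a common neighbour of the ends of any edge, so it can be
removed without affecting the conclusion. *)
Lemma exposed_triangle g x y z :
    symmetric g -> irreflexive g -> chordal_graph g ->
    g x y -> g y z -> g x z ->
  exists u v w, [/\ g u v, g u w, g v w & exposed g u v].
Proof.
move=> sym irr ch gxy gyz gxz.
suff [u [v [w [uS vS guv guw [gvw exp]]]]] : exists u v w,
    [/\ u \in [set: T], v \in [set: T], g u v, g u w &
        g v w /\ gclique g [set c in [set: T] | g u c && g v c]].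
  exists u, v, w; split=> //; apply: gclique_sub exp; apply/subsetP => c.
  by rewrite !inE.
have : [set x; y; z] \subset [set: T] by exact: subsetT.
move: [set: T] => S; have [m] := ubnP #|S|; elim: m S => // m IH S leSm tri.
have triS c : c \in [set x; y; z] -> c \in S by move/(subsetP tri).
have [w wS /gcliqueP simw] : exists2 w, w \in S & gsimplicial g S w.
  by apply: ch; apply/set0Pn; exists x; apply: triS; rewrite !inE eqxx.
case: (boolP [exists p in S, exists q in S, [&& p != q, g w p & g w q]]).
  case/exists_inP => p pS /exists_inP[q qS /and3P[npq wp wq]].
  exists w, p, q; split=> //; split; first by apply: simw; rewrite ?inE ?pS ?qS.
  apply: gclique_sub (introT (gcliqueP _ _) simw); apply/subsetP => c.
  by rewrite !inE => /and3P[-> -> _].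
move=> /exists_inPn nodeg.
have deg p q : p \in S -> q \in S -> g w p -> g w q -> p = q.
  move=> pS qS wp wq; apply: contraNeq (nodeg p pS) => npq.
  by apply/exists_inP; exists q => //; rewrite npq wp wq.
have nodiag p q : p \in S -> q \in S -> g p q -> ~~ (g w p && g w q).
  move=> pS qS gpq; apply/negP => /andP[wp wq].
  by move: gpq; rewrite (deg _ _ pS qS wp wq) irr.
have [xS yS zS] : [/\ x \in S, y \in S & z \in S].
  by split; apply: triS; rewrite !inE eqxx ?orbT.
have ltS : #|S :\ w| < m by move: leSm; rewrite (cardsD1 w S) wS.
have triw : [set x; y; z] \subset S :\ w.
  rewrite !subUset !sub1set !in_setD1 xS yS zS !andbT -andbA.
  apply/and3P; split; apply/eqP => E.
  - by move: (nodiag y z yS zS gyz); rewrite -E gxy gxz.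
  - by move: (nodiag x z xS zS gxz); rewrite -E gyz sym gxy.
  - by move: (nodiag x y xS yS gxy); rewrite -E ![g z _]sym gxz gyz.
have [u [v [c [uS vS guv guc [gvc /gcliqueP exp]]]]] := IH _ ltS triw.
move: uS vS; rewrite !in_setD1 => /andP[_ uS] /andP[_ vS].
exists u, v, c; split=> //; split=> //; apply/gcliqueP => p q.
have inN t : t \in [set c in S | g u c && g v c] ->
    t \in [set c in S :\ w | g u c && g v c].
  rewrite !inE => /andP[tS /andP[ut vt]]; rewrite tS ut vt !andbT.
  apply/eqP => E; move: (nodiag u v uS vS guv).
  by rewrite -E ![g t _]sym ut vt.
by move=> /inN pN /inN qN; apply: exp.
Qed.
End ChordalGraphs.

(** * Simplicial sequences of the complete clutter *)

Section SimplicialSequences.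
Variable T : finType.
Implicit Types (d m : nat) (es p s : seq {set T}) (e F G H N : {set T}).

Definition free es F : bool := ~~ has (fun f : {set T} => f \subset F) es.

Lemma freeP es F :
  reflect (forall f, f \in es -> ~~ (f \subset F)) (free es F).
Proof. by apply: (iffP hasPn). Qed.

Lemma mem_deletions d es F :
  (F \in deletions (complete_clutter T d) es) = (#|F| == d) && free es F.
Proof.
rewrite /deletions /free; elim/last_ind: es => [|es e IH]; first by rewrite inE andbT.
by rewrite foldl_rcons /deletion inE IH has_rcons negb_or -andbA [~~ _ && ~~ _]andbC.
Qed.

Lemma cliqueE d (C : {set {set T}}) F :
  clique d C F <-> (forall G, G \subset F -> #|G| = d -> G \in C).
Proof.
split=> [[ltF | //] | cl]; last by right.
move=> G sGF cG; move: (subset_leq_card sGF).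
by rewrite cG leqNgt ltF.
Qed.

(** The closed neighbourhood of e in the clutter left after deleting es from the
complete clutter, when e is itself free; see [neighborhoodE]. *)
Definition nbhd es e : {set T} := [set c | free es (c |: e)].

Lemma free_self d es e :
    (forall f, f \in es -> #|f| = d) -> #|e| = d -> e \notin es -> free es e.
Proof.
move=> ces ce nees; apply/freeP => f fes; apply: contra nees => sfe.
suff <- : f = e by [].
by apply/eqP; rewrite eqEcard sfe ce (ces f fes) leqnn.
Qed.

Lemma setU1_mem c e : c \in e -> c |: e = e.
Proof. by move=> ce; apply/setUidPr; rewrite sub1set. Qed.

Lemma sub_nbhd es e : free es e -> e \subset nbhd es e.
Proof. by move=> fe; apply/subsetP => c ce; rewrite inE setU1_mem. Qed.

Lemma neighborhoodE d es e : #|e| = d -> free es e ->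
  neighborhood (deletions (complete_clutter T d.+1) es) e = nbhd es e.
Proof.
move=> ce fe; apply/setP => c; rewrite !inE mem_deletions cardsU1 ce.
by have [cE | _] := boolP (c \in e); rewrite ?(setU1_mem cE) ?fe ?eqxx.
Qed.

(** The closed neighbourhood N is a clique when no deleted f lies in a d+1-subset
of N.  A deleted f inside N always lies in such a subset: since e is not f and
the two have equal size, some c of N is outside f. *)
Lemma simplicial_free d es e :
    (forall f, f \in es -> #|f| = d) -> #|e| = d -> e \notin es ->
  simplicial d.+1 (deletions (complete_clutter T d.+1) es) e
    <-> free es (nbhd es e).
Proof.
move=> ces ce nees; have fe := free_self ces ce nees.
rewrite /simplicial neighborhoodE //; split=> [[_ /cliqueE cl] | fN]; last first.
  split=> //; apply/cliqueE => G sGN cG; rewrite mem_deletions cG eqxx /=.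
  apply/freeP => f fes; apply: contra (freeP _ _ fN f fes) => sfG.
  exact: subset_trans sfG sGN.
apply/freeP => f fes; apply/negP => sfN.
have [c cN ncf] : exists2 c, c \in nbhd es e & c \notin f.
  apply/subsetPn/negP => sNf; case/negP: nees.
  suff -> : e = f by [].
  apply/eqP; rewrite eqEcard (ces f fes) ce leqnn andbT.
  exact: subset_trans (sub_nbhd fe) sNf.
have : c |: f \in deletions (complete_clutter T d.+1) es.
  by apply: cl; rewrite ?subUset ?sub1set ?cN // cardsU1 ncf (ces f fes).
rewrite mem_deletions => /andP[_ /freeP/(_ f fes)].
by rewrite subsetUr.
Qed.

Lemma simplicial_sequence_rcons d (C : {set {set T}}) es e :
  simplicial_sequence d C (rcons es e) <->
  simplicial_sequence d C es /\ simplicial d (deletions C es) e.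
Proof.
split=> [ss | [ss se] i].
  split=> [i lti | ].
    have := ss i; rewrite size_rcons ltnS (ltnW lti) => /(_ isT).
    by rewrite nth_rcons lti -cats1 takel_cat // ltnW.
  have := ss (size es); rewrite size_rcons leqnn => /(_ isT).
  by rewrite nth_rcons ltnn eqxx -cats1 take_size_cat.
rewrite size_rcons ltnS leq_eqVlt => /predU1P[-> | lti].
  by rewrite nth_rcons ltnn eqxx -cats1 take_size_cat.
by rewrite nth_rcons lti -cats1 takel_cat ?(ltnW lti) //; apply: ss.
Qed.

Lemma simplicial_sequence_card d (C : {set {set T}}) es f :
  simplicial_sequence d C es -> f \in es -> #|f| = d.-1.
Proof.
move=> ss fes; have := ss (index f es); rewrite index_mem => /(_ fes) [].
by rewrite nth_index.
Qed.

(** The graph of undeleted pairs; for d = 3 its triangles are the circuits that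
are left. *)
Definition adj es : rel T := [rel x y | (x != y) && ([set x; y] \notin es)].

Lemma adj_sym es : symmetric (adj es).
Proof. by move=> x y; rewrite /adj /= eq_sym setUC. Qed.

Lemma adj_irr es : irreflexive (adj es).
Proof. by move=> x; rewrite /adj /= eqxx. Qed.

Lemma free_adj es N : (forall f, f \in es -> #|f| = 2) ->
  free es N = gclique (adj es) N.
Proof.
move=> ces; apply/freeP/gcliqueP => [fN x y xN yN nxy | cl f fes].
  rewrite /adj /= nxy; apply/negP => /fN.
  by rewrite subUset !sub1set xN yN.
have /eqP/cards2P[x [y [nxy E]]] := ces f fes; rewrite E subUset !sub1set.
apply/negP => /andP[xN yN]; have := cl x y xN yN nxy.
by rewrite /adj /= -E fes andbF.
Qed.

(** A vertex c outside uv makes the triple cuv free exactly when c is adjacent to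
both u and v, which identifies clutter neighbourhoods with common
neighbourhoods in the graph. *)
Lemma nbhd_adj es u v : (forall f, f \in es -> #|f| = 2) -> adj es u v ->
  nbhd es [set u; v] = u |: (v |: [set c | adj es u c && adj es v c]).
Proof.
move=> ces auv; have sym := @adj_sym es.
have cluv : gclique (adj es) [set u; v].
  rewrite gcliqueU1 //; apply/andP; split.
    by apply/gcliqueP => x y; rewrite !inE => /eqP-> /eqP->; rewrite eqxx.
  by apply/forall_inP => y /set1P->; rewrite auv implybT.
apply/setP => c; rewrite in_set free_adj // gcliqueU1 // cluv 2!in_setU1 in_set.
have [-> | ncu] := eqVneq c u.
  by apply/forall_inP => y; rewrite !inE => /orP[]/eqP->; rewrite ?eqxx ?auv ?implybT.
have [-> | ncv] := eqVneq c v.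
  by apply/forall_inP => y; rewrite !inE sym => /orP[]/eqP->; rewrite ?eqxx ?auv ?implybT.
rewrite !(sym _ c); apply/forall_inP/andP => [cl | [cu cv] y].
  have /implyP cu := cl u (set21 u v); have /implyP cv := cl v (set22 u v).
  by split; [apply: cu | apply: cv]; rewrite eq_sym.
by rewrite !inE => /orP[]/eqP->; rewrite ?cu ?cv implybT.
Qed.

Lemma free_nbhd_adj es u v : (forall f, f \in es -> #|f| = 2) -> adj es u v ->
  free es (nbhd es [set u; v]) = exposed (adj es) u v.
Proof.
move=> ces auv; rewrite free_adj // nbhd_adj //.
rewrite !gcliqueU1; [|exact: adj_sym..]; rewrite -andbA /exposed.
case: gclique => //=; apply/andP; split; apply/forall_inP => y.
  by rewrite in_set => /andP[_ ->]; rewrite implybT.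
by rewrite in_setU1 in_set => /predU1P[-> | /andP[-> _]]; rewrite ?auv implybT.
Qed.

End SimplicialSequences.
(** * Extending simplicial sequences *)

Section Chordality.
Variable T : finType.
Implicit Types (d : nat) (es : seq {set T}) (e : {set T}).

(** Every term of the sequence either repeats an earlier deletion, which changes
nothing, or erases an edge that is exposed because it is simplicial. *)
Lemma chordal_adj es :
  simplicial_sequence 3 (complete_clutter T 3) es -> chordal_graph (adj es).
Proof.
elim/last_ind: es => [_ S /set0Pn[v vS] | es e IH].
  exists v => //; apply/gcliqueP => x y _ _ nxy.
  by rewrite /adj /= nxy.
move=> /simplicial_sequence_rcons[ss se]; have ch := IH ss.
have ces f : f \in es -> #|f| = 2 by apply: simplicial_sequence_card ss.
have [ees | nees] := boolP (e \in es).
  apply: chordal_graph_eq ch => x y; rewrite /adj /= mem_rcons in_cons.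
  by case: (eqVneq _ e) => // ->; rewrite ees.
have [ce _] := se; have /eqP/cards2P[u [v [nuv E]]] := ce.
have auv : adj es u v by rewrite /adj /= nuv -E.
have /(simplicial_free ces ce nees) := se; rewrite E free_nbhd_adj // => exp.
apply: chordal_graph_eq (chordal_graph_erase (@adj_sym _ es) (@adj_irr _ es) ch exp).
by move=> x y; rewrite /erase /adj /= mem_rcons in_cons negb_or -E -andbA [~~ _ && ~~ _]andbC.
Qed.

Lemma maximal_subcircuit_nbhd d es e c :
    #|e| = d -> free es e -> c \notin e -> c \in nbhd es e ->
  maximal_subcircuit d.+1 (deletions (complete_clutter T d.+1) es) e.
Proof.
move=> ce fe nce cN; split=> //; rewrite neighborhoodE // => E.
by rewrite -E cN in nce.
Qed.

(** Once e is deleted no circuit contains it, so its neighbourhood is trivial. *)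
Lemma maximal_subcircuit_notin d es e :
    maximal_subcircuit d (deletions (complete_clutter T d) es) e ->
  e \notin es.
Proof.
case=> _ nNe; apply/negP => ees; case: nNe; apply/setP => c.
rewrite !inE mem_deletions; case: freeP => [/(_ e ees)|_]; last by rewrite andbF orbF.
by rewrite subsetUr.
Qed.

(** This is where the bound on d enters.  For d = 2 any vertex of a remaining
edge works; for d = 3 it is an exposed edge in a triangle of [adj es]. *)
Lemma exists_simplicial_subcircuit d es :
    d \in [:: 2; 3] -> simplicial_sequence d (complete_clutter T d) es ->
    deletions (complete_clutter T d) es != set0 ->
  exists e, maximal_subcircuit d (deletions (complete_clutter T d) es) e
         /\ simplicial d (deletions (complete_clutter T d) es) e.
Proof.
move=> d23 ss /set0Pn[F]; rewrite mem_deletions => /andP[/eqP cF fF].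
have ces f : f \in es -> #|f| = d.-1 by apply: simplicial_sequence_card ss.
have sub_free (G : {set T}) : G \subset F -> free es G.
  move=> sGF; apply/freeP => f fes; apply: contra (freeP _ _ fF f fes) => sfG.
  exact: subset_trans sfG sGF.
have notin (f : {set T}) : f \subset F -> f \notin es.
  by move=> sfF; apply: contraL sfF => /(freeP _ _ fF).
move: d23; rewrite !inE => /orP[] /eqP Ed; rewrite {d}Ed in ss cF ces *.
  have /eqP/cards2P[a [b [nab E]]] := cF.
  have saF : [set a] \subset F by rewrite E sub1set set21.
  exists [set a]; split.
    apply: (@maximal_subcircuit_nbhd _ _ _ b); rewrite ?cards1 ?sub_free //.
      by rewrite inE eq_sym.
    by rewrite inE setUC sub_free // E.
  apply/(simplicial_free ces (cards1 a) (notin _ saF)).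
  apply/freeP => f fes; have /eqP/cards1P[x Ex] := ces f fes.
  rewrite Ex sub1set inE; apply/negP => /freeP/(_ f fes).
  by rewrite Ex sub1set setU11.
have [x xF] : exists x, x \in F by apply/set0Pn; rewrite -card_gt0 cF.
have /cards2P[y [z [nyz E]]] : #|F :\ x| == 2.
  by move: cF; rewrite (cardsD1 x) xF add1n => -[->].
have [] : y \in F :\ x /\ z \in F :\ x by rewrite E set21 set22.
rewrite !in_setD1 => /andP[nyx yF] /andP[nzx zF].
have /gcliqueP cl : gclique (adj es) F by rewrite -free_adj.
have [||| u [v [w [auv auw avw exp]]]] :=
  exposed_triangle (@adj_sym _ es) (@adj_irr _ es) (chordal_adj ss) (x := x) (y := y) (z := z).
- by apply: cl; rewrite // eq_sym.
- exact: cl.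
- by apply: cl; rewrite // eq_sym.
have neq a b : adj es a b -> a != b by case/andP.
have cuv : #|[set u; v]| = 2 by rewrite cards2 neq.
have nuv : [set u; v] \notin es by case/andP: auv.
exists [set u; v]; split.
  apply: (@maximal_subcircuit_nbhd _ _ _ w) => //; first exact: free_self ces _ _.
    by rewrite !inE negb_or ![w == _]eq_sym !neq.
  by rewrite nbhd_adj // 2!in_setU1 in_set auw avw !orbT.
by apply/simplicial_free => //; rewrite free_nbhd_adj.
Qed.

Lemma chordal_deletions d es :
    d \in [:: 2; 3] -> simplicial_sequence d (complete_clutter T d) es ->
  chordal d (deletions (complete_clutter T d) es).
Proof.
move=> d23; have [m] := ubnP #|deletions (complete_clutter T d) es|.
elim: m es => // m IH es lem ss; set C := deletions _ es in lem *.
have [-> | C0] := eqVneq C set0; first exact: chordal_empty.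
have [e [max_e sim_e]] := exists_simplicial_subcircuit d23 ss C0.
apply: (chordal_deletion _ max_e sim_e).
  by move=> F; rewrite mem_deletions => /andP[/eqP].
rewrite /C /deletions -foldl_rcons; apply: IH; last first.
  exact/simplicial_sequence_rcons.
rewrite /deletions foldl_rcons -/(deletions _ es) -/C.
suff [c cC] : exists c, c |: e \in C.
  rewrite ltnS in lem; apply: leq_trans lem; apply: proper_card.
  apply/properP; split; first by apply/subsetP => F; rewrite inE => /andP[].
  by exists (c |: e); rewrite // inE subsetUr andbF.
have [_ nNe] := max_e.
have [/existsP[c cC] | /existsPn noC] := boolP [exists c, c |: e \in C]; first by exists c.
case: nNe; apply/setP => c; rewrite !inE.
by rewrite (negPf (noC c)) orbF.
Qed.

End Chordality.

(** * Shellings and complements of facets *)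

Section Shellings.
Variable T : finType.
Implicit Types (D E A : {set {set T}}) (F G H N R : {set T}) (p s : seq {set T}).

(** The condition on a single step of a shelling: F can follow the facets p. *)
Definition attaches p F : Prop := exists A : {set {set T}},
  [/\ A != set0, A \subset maximal_proper_faces F &
      generated [set G in p] :&: generated [set F] = generated A].

Definition shelling_steps s : Prop :=
  forall k, 0 < k < size s -> attaches (take k s) (nth set0 s k).

Lemma mem_generated A H :
  reflect (exists2 F, F \in A & H \subset F) (H \in generated A).
Proof. by rewrite inE; apply: exists_inP. Qed.

Lemma maximal_proper_facesP F R :
  reflect (exists2 x, x \in F & R = F :\ x) (R \in maximal_proper_faces F).
Proof.
rewrite inE; apply: (iffP maxsetP) => [[/properP[sRF [x xF nxR]] maxR] | [x xF ->]].
  exists x => //; apply/esym/maxR; first exact: properD1.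
  by rewrite subsetD1 sRF nxR.
split=> [|B prB sB]; first exact: properD1.
apply/eqP; rewrite eq_sym eqEcard sB -ltnS.
by move: (proper_card prB); rewrite (cardsD1 x F) xF.
Qed.

Lemma free_setC p N :
  reflect (forall G, G \in p -> ~~ (~: G \subset N)) (free (map (@setC T) p) N).
Proof.
apply: (iffP (freeP _ _)) => [fN G Gp | fN f /mapP[G Gp ->]]; last exact: fN.
by apply: fN; apply: map_f.
Qed.

(** A member of p contains F minus x exactly when its complement is contained in
the complement of F enlarged by x. *)
Lemma free_setC_setU1 p F x :
  (free (map (@setC T) p) (x |: ~: F)) = (F :\ x \notin generated [set G in p]).
Proof.
have compl G : (~: G \subset x |: ~: F) = (F :\ x \subset G).
  by rewrite -setCS setCU !setCK setDE setIC.
apply/free_setC/negP => [fx /mem_generated[G] | nF G Gp].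
  by rewrite inE => /fx; rewrite compl => /negP.
rewrite compl; apply/negP => sG; case: nF.
by apply/mem_generated; exists G; rewrite ?inE.
Qed.

(** By [free_setC_setU1] the ridges of F inside the complex of p are the F minus x
with x outside N, and all of them must be used as generators.  A face G :&: F,
with G in p, lies in one of them exactly when the complement of G contains a
point x outside N. *)
Lemma attachesP p F :
    free (map (@setC T) p) (~: F) -> p != [::] ->
  attaches p F <-> free (map (@setC T) p) (nbhd (map (@setC T) p) (~: F)).
Proof.
move=> fF p0; set N := nbhd _ _.
have inN x : (x \in N) = (F :\ x \notin generated [set G in p]).
  by rewrite inE free_setC_setU1.
split=> [[A [_ /subsetP maxA eqA]] | /free_setC fN].
  apply/free_setC => G Gp; apply/negP => sGN.
  have /mem_generated[R RA sR] : G :&: F \in generated A.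
    rewrite -eqA inE; apply/andP; split; apply/mem_generated.
      by exists G; rewrite ?inE ?subsetIl.
    by exists F; rewrite ?inE ?subsetIr.
  have /maximal_proper_facesP[x xF ER] := maxA R RA.
  have nxN : x \notin N.
    rewrite inN negbK -ER.
    have : R \in generated A by apply/mem_generated; exists R.
    by rewrite -eqA inE => /andP[].
  have xG : x \in G by apply: contraR nxN => nxG; apply: (subsetP sGN); rewrite inE.
  have : x \in R by apply: (subsetP sR); rewrite inE xG.
  by rewrite ER !inE eqxx.
have outN G : G \in p -> exists2 x, x \notin G & x \notin N.
  by move=> /fN/subsetPn[x]; rewrite inE; exists x.
have NF x : x \notin N -> x \in F.
  by apply: contraNT => nxF; apply: (subsetP (sub_nbhd fF)); rewrite inE.
exists [set F :\ x | x in ~: N]; split.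
- have [G Gp] : exists G, G \in p by case: p p0 {fF N inN fN outN NF} => // G p _; exists G; rewrite mem_head.
  have [x _ xN] := outN G Gp.
  by apply/set0Pn; exists (F :\ x); apply: imset_f; rewrite inE.
- apply/subsetP => R /imsetP[x]; rewrite inE => /NF xF ->.
  by apply/maximal_proper_facesP; exists x.
apply/setP => H; rewrite inE; apply/andP/mem_generated.
  case=> /mem_generated[G]; rewrite inE => Gp sHG /mem_generated[F' /set1P-> sHF].
  have [x nxG nxN] := outN G Gp.
  exists (F :\ x); first by apply: imset_f; rewrite inE.
  by rewrite subsetD1 sHF; apply: contra nxG; apply: (subsetP sHG).
case=> R /imsetP[x]; rewrite inE inN negbK => /mem_generated[G Gp sG] -> sH.
split; apply/mem_generated; first by exists G => //; apply: subset_trans sG.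
by exists F; rewrite ?inE //; apply: subset_trans (subD1set F x).
Qed.

Lemma shelling_steps_rcons s F :
  shelling_steps (rcons s F) <->
  shelling_steps s /\ (s != [::] -> attaches s F).
Proof.
split=> [st | [st aF] k].
  split=> [k /andP[k0 ltk] | ].
    have := st k; rewrite size_rcons k0 ltnS (ltnW ltk) => /(_ isT).
    by rewrite nth_rcons ltk -cats1 takel_cat // ltnW.
  rewrite -size_eq0 -lt0n => s0.
  have := st (size s); rewrite size_rcons s0 leqnn => /(_ isT).
  by rewrite nth_rcons ltnn eqxx -cats1 take_size_cat.
rewrite size_rcons ltnS => /andP[k0]; rewrite leq_eqVlt => /predU1P[Ek | ltk].
  rewrite nth_rcons Ek ltnn eqxx -cats1 take_size_cat //; apply: aF.
  by rewrite -size_eq0 -lt0n -Ek.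
by rewrite nth_rcons ltk -cats1 takel_cat ?(ltnW ltk) //; apply: st; rewrite k0.
Qed.

(** Only the shelling steps matter, so it suffices to add one facet at a time; the
facet G that is added may differ from the missing facet F. *)
Lemma extendably_shellable_step D :
    (forall s, uniq s -> {subset s <= facets D} -> shelling_steps s ->
       forall F, F \in facets D -> F \notin s ->
     exists G, [/\ G \in facets D, G \notin s & s != [::] -> attaches s G]) ->
  extendably_shellable D.
Proof.
move=> ext E s _ _ /subsetP sED [us Es st].
have {E Es sED} : {subset s <= facets D}.
  by move=> F Fs; apply: sED; rewrite -Es inE.
have [m] := ubnP (#|facets D| - size s); elim: m s us st => // m IH s us st lem sD.
have [/subsetP all_s | /subsetPn[F FD nFs]] := boolP (facets D \subset [set F in s]).
  exists [::]; rewrite cats0; split=> //; apply/setP => F; rewrite inE.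
  by apply/idP/idP => [/sD | /all_s]; rewrite ?inE.
rewrite inE in nFs.
have [G [GD nGs aG]] := ext s us sD st F FD nFs.
have [|||| s' sh] := IH (rcons s G).
- by rewrite rcons_uniq nGs.
- exact/shelling_steps_rcons.
- have : size (rcons s G) <= #|facets D|.
    rewrite -(card_uniqP _) ?rcons_uniq ?nGs //; apply/subset_leq_card/subsetP => H.
    by rewrite mem_rcons in_cons => /predU1P[-> | /sD].
  rewrite size_rcons => lts; rewrite subnS -ltnS prednK ?subn_gt0 //.
- by move=> H; rewrite mem_rcons in_cons => /predU1P[-> | /sD].
by exists (G :: s'); rewrite -cat_rcons.
Qed.

Lemma facets_skeleton_full i : #|T| <= i.+1 ->
  facets (skeleton i (generated [set [set: T]])) = [set [set: T]].
Proof.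
move=> leT; apply/setP => F; rewrite !inE.
have memD G : G \in skeleton i (generated [set [set: T]]).
  rewrite inE (leq_trans (max_card _) leT) andbT.
  by apply/mem_generated; exists [set: T]; rewrite ?inE ?subsetT.
apply/maxsetP/eqP => [[_ maxF] | ->].
  by rewrite -(maxF setT) ?subsetT.
by split=> // B _; rewrite subTset => /eqP.
Qed.

Lemma facets_skeleton i : i < #|T| ->
  facets (skeleton i (generated [set [set: T]])) = [set F : {set T} | #|F| == i.+1].
Proof.
move=> ltT; have memD G : (G \in skeleton i (generated [set [set: T]])) = (#|G| <= i.+1).
  rewrite inE andb_idl // => _.
  by apply/mem_generated; exists [set: T]; rewrite ?inE ?subsetT.
apply/setP => F; rewrite !inE; apply/maxsetP/eqP => [[] | cF].
  rewrite memD leq_eqVlt => /predU1P[// | ltF] maxF.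
  have /subsetPn[c _ ncF] : ~~ ([set: T] \subset F).
    rewrite subTset; apply: contraL (leq_trans ltF ltT) => /eqP->.
    by rewrite cardsT ltnn.
  have := maxF (c |: F); rewrite memD cardsU1 ncF => /(_ ltF (subsetUr _ _)) E.
  by rewrite -E setU11 in ncF.
split=> [|B]; first by rewrite memD cF.
by rewrite memD => cB sFB; apply/eqP; rewrite eq_sym eqEcard sFB cF.
Qed.

Lemma simplicial_sequence_setC d s :
    uniq s -> (forall F, F \in s -> #|~: F| = d) -> shelling_steps s ->
  simplicial_sequence d.+1 (complete_clutter T d.+1) (map (@setC T) s).
Proof.
elim/last_ind: s => [|s F IH]; first by [].
rewrite rcons_uniq map_rcons => /andP[nFs us] cs /shelling_steps_rcons[st aF].
have cF : #|~: F| = d by apply: cs; rewrite mem_rcons mem_head.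
have {}cs G : G \in s -> #|~: G| = d.
  by move=> Gs; apply: cs; rewrite mem_rcons in_cons Gs orbT.
apply/simplicial_sequence_rcons; split; first exact: IH.
have ces f : f \in map (@setC T) s -> #|f| = d by case/mapP => G /cs cG ->.
have nFC : ~: F \notin map (@setC T) s by rewrite mem_map //; apply: setC_inj.
apply/simplicial_free => //.
(* The first facet carries no condition: nothing has been deleted yet. *)
have [-> // | s0] := eqVneq s [::].
by apply/attachesP => //; [apply: free_self cF nFC | apply: aF].
Qed.

Lemma extendably_shellable_skeleton i : #|T| <= i + 3 ->
  extendably_shellable (skeleton i (generated [set [set: T]])).
Proof.
move=> leT; apply: extendably_shellable_step => s us.
have [leT' | ltT] := leqP #|T| i.+1.
  rewrite facets_skeleton_full // => sD _ F /set1P-> nFs.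
  exists setT; rewrite inE; split=> //.
  case: s sD nFs {us} => // G s sD; have /set1P-> := sD G (mem_head _ _).
  by rewrite mem_head.
rewrite facets_skeleton; last exact: ltnW.
move=> sD st F; rewrite inE => cF nFs.
(* The complements of the facets have d elements, so the clutter is (d+1)-uniform. *)
pose d := #|T| - i.+1.
have d23 : d.+1 \in [:: 2; 3].
  suff : 0 < d <= 2 by rewrite !inE; case: (d) => [|[|[|]]].
  by rewrite subn_gt0 ltT leq_subLR addSn addn2 -addn3.
have cC G : (#|~: G| == d) = (#|G| == i.+1).
  rewrite -(eqn_add2l #|G|) cardsC -(subnKC (ltnW ltT : i.+1 <= _)).
  by rewrite eqn_add2r eq_sym.
have cs G : G \in s -> #|~: G| = d by move=> /sD; rewrite inE -cC => /eqP.
have ss := simplicial_sequence_setC us cs st.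
have ces f : f \in map (@setC T) s -> #|f| = d by case/mapP => G /cs cG ->.
suff [e [nes sim_e]] : exists e, e \notin map (@setC T) s /\
    simplicial d.+1 (deletions (complete_clutter T d.+1) (map (@setC T) s)) e.
  have [ce _] := sim_e; exists (~: e); split.
  - by rewrite inE -cC setCK ce.
  - by apply: contra nes => es; rewrite -[e]setCK map_f.
  - move=> s0; apply/attachesP => //; rewrite setCK; first exact: free_self ces _ _.
    by apply/(simplicial_free ces ce nes).
(* Without circuits every missing complement e has N = e and is simplicial. *)
have [C0 | Cn0] := eqVneq (deletions (complete_clutter T d.+1) (map (@setC T) s)) set0.
  exists (~: F); split; first by rewrite mem_map //; apply: setC_inj.
  have ceF : #|~: F| = d by apply/eqP; rewrite cC.
  split=> //; left; suff -> : neighborhood (deletions (complete_clutter T d.+1) (map (@setC T) s)) (~: F) = ~: F.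
    by rewrite ceF.
  by apply/setP => c; rewrite C0 !inE orbF.
have [e [max_e sim_e]] := exists_simplicial_subcircuit d23 ss Cn0.
by exists e; split; first exact: maximal_subcircuit_notin max_e.
Qed.

End Shellings.

Theorem corollary3p8 :
  (forall (d n : nat) (es : seq {set 'I_n}),
     d \in [:: 2; 3] -> 0 < n ->
     simplicial_sequence d (complete_clutter 'I_n d) es ->
     chordal d (deletions (complete_clutter 'I_n d) es))
  /\
  (forall n i : nat,
     0 < n -> n <= i + 3 ->
     extendably_shellable (skeleton i (generated [set [set: 'I_n]]))).
Proof.
split=> [d n es d23 _ | n i _ leni]; first exact: chordal_deletions.
by apply: extendably_shellable_skeleton; rewrite card_ord.
Qed.
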